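(* Let $\mathcal{G}$ be a magmoidal category with unit $(1,l,r)$. Then the category $\mathcal{N}^1_l(\mathcal{G})$ is monoidal, with tensor product $(A,a)\otimes(B,b)=(A\otimes B,a|b)$ and associativity constraint $\phi_{(A,a),(B,b),(C,c)}=a_{B,C}$, with unit object $(1,i)$, and with unit natural isomorphisms $$l_{(A,a)}:(1,i)\otimes(A,a)\to(A,a),\qquad r_{(A,a)}:(A,a)\otimes(1,i)\to(A,a)$$ defined by $l_{(A,a)}=l_A$, $r_{(A,a)}=r_A$.
   Context: A magmoidal category is a category $\mathcal{G}$ with a functor $\otimes:\mathcal{G}\times\mathcal{G}\to\mathcal{G}$, with no associativity condition. A unit is an object $1\in\mathcal{G}$ with natural isomorphisms $l_X:1\otimes X\to X$, $r_X:X\otimes1\to X$ such that $l_1=r_1$. An object's name also denotes its identity morphism. The left nucleus $\mathcal{N}_l(\mathcal{G})$ has as objects pairs $(A,a)$, with $A\in\mathcal{G}$ and $a$ a family of isomorphisms $a_{X,Y}:A\otimes(X\otimes Y)\to(A\otimes X)\otimes Y$ natural in $X,Y$. A morphism $(A,a)\to(B,b)$ is a morphism $f:A\to B$ of $\mathcal{G}$ such that $((f\otimes X)\otimes Y)\circ a_{X,Y}=b_{X,Y}\circ(f\otimes(X\otimes Y))$ for all $X,Y$. The tensor product is $(A,a)\otimes(B,b)=(A\otimes B,a|b)$, where $(a|b)_{X,Y}:(A\otimes B)\otimes(X\otimes Y)\to((A\otimes B)\otimes X)\otimes Y$ is defined by $$(a|b)_{X,Y}\circ a_{B,X\otimes Y}=(a_{B,X}\otimes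 Y)\circ a_{B\otimes X,Y}\circ(A\otimes b_{X,Y});$$ on morphisms it is the tensor product of $\mathcal{G}$. The left unital nucleus $\mathcal{N}^1_l(\mathcal{G})$ is the full subcategory of $\mathcal{N}_l(\mathcal{G})$ of those $(A,a)$ satisfying the normalisation conditions, for all $X\in\mathcal{G}$, $$(r_A\otimes X)\circ a_{1,X}=A\otimes l_X,\qquad r_{A\otimes X}\circ a_{X,1}=A\otimes r_X.$$ The family $i$ is given by $i_{X,Y}=(l_X\otimes Y)^{-1}\circ l_{X\otimes Y}:1\otimes(X\otimes Y)\to(1\otimes X)\otimes Y$. *)

(* Defs.v *)
(* Plain Rocq with the ssreflect tactic language; no mathematical library. *)
From Stdlib Require Import ssreflect ProofIrrelevance.

Set Implicit Arguments.
Unset Strict Implicit.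
Unset Printing Implicit Defensive.

Record category := Category {
  ob :> Type;
  hom : ob -> ob -> Type;
  id : forall A, hom A A;
  comp : forall A B C, hom B C -> hom A B -> hom A C;
  comp_id_l : forall A B (f : hom A B), comp (id B) f = f;
  comp_id_r : forall A B (f : hom A B), comp f (id A) = f;
  comp_assoc : forall A B C D (h : hom C D) (g : hom B C) (f : hom A B),
    comp h (comp g f) = comp (comp h g) f }.

Arguments hom {c} A B.
Arguments id {c} A.
Arguments comp {c A B C} g f.

Declare Scope cat_scope.
Delimit Scope cat_scope with cat.
Open Scope cat_scope.

Notation "g ∘ f" := (comp g f) (at level 40, left associativity) : cat_scope.

Record iso (C : category) (A B : C) := Iso {
  fwd :> hom A B;
  bwd : hom B A;
  fwd_bwd : fwd ∘ bwd = id B;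
  bwd_fwd : bwd ∘ fwd = id A }.

Arguments iso {C} A B.

Lemma iso_epi (C : category) (A B D : C) (i : iso A B) (g h : hom B D) :
  g ∘ i = h ∘ i -> g = h.
Proof.
move=> E; rewrite -(comp_id_r g) -(comp_id_r h) -(fwd_bwd i).
by rewrite !comp_assoc E.
Qed.

Definition iso_comp (C : category) (A B D : C) (g : iso B D) (f : iso A B) :
  iso A D.
Proof.
refine (@Iso C A D (g ∘ f) (bwd f ∘ bwd g) _ _).
- by rewrite comp_assoc -(comp_assoc _ f) fwd_bwd comp_id_r fwd_bwd.
- by rewrite comp_assoc -(comp_assoc _ (bwd g)) bwd_fwd comp_id_r bwd_fwd.
Defined.

Definition iso_inv (C : category) (A B : C) (f : iso A B) : iso B A :=
  Iso (bwd_fwd f) (fwd_bwd f).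

Definition iso_id (C : category) (A : C) : iso A A :=
  Iso (comp_id_l (id A)) (comp_id_l (id A)).

(* The fields other than the underlying category say that the tensor product
   is a functor from the product of the category with itself. *)
Record magmoidal := Magmoidal {
  cat_of :> category;
  tens : cat_of -> cat_of -> cat_of;
  tensm : forall A B C D : cat_of,
    hom A B -> hom C D -> hom (tens A C) (tens B D);
  tensm_id : forall A B : cat_of, tensm (id A) (id B) = id (tens A B);
  tensm_comp : forall (A B C A' B' C' : cat_of)
    (g : hom B C) (f : hom A B) (g' : hom B' C') (f' : hom A' B'),
    tensm (g ∘ f) (g' ∘ f') = tensm g g' ∘ tensm f f' }.

Arguments tens {m} A B.
Arguments tensm {m A B C D} f g.

Notation "A ⊗ B" := (tens A B) (at level 39, left associativity) : cat_scope.
Notation "f ⊠ g" := (tensm f g) (at level 39, left associativity) : cat_scope.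

Definition iso_tens (G : magmoidal) (A B C D : G) (f : iso A B) (g : iso C D) :
  iso (A ⊗ C) (B ⊗ D).
Proof.
refine (@Iso G (A ⊗ C) (B ⊗ D) (f ⊠ g) (bwd f ⊠ bwd g) _ _).
- by rewrite -tensm_comp !fwd_bwd tensm_id.
- by rewrite -tensm_comp !bwd_fwd tensm_id.
Defined.

(* [unit_structure one]: the data making the object [one] a unit. *)
Record unit_structure (G : magmoidal) (one : G) := UnitStructure {
  lu : forall X : G, iso (one ⊗ X) X;
  ru : forall X : G, iso (X ⊗ one) X;
  lu_natural : forall (X Y : G) (f : hom X Y), f ∘ lu X = lu Y ∘ (id one ⊠ f);
  ru_natural : forall (X Y : G) (f : hom X Y), f ∘ ru X = ru Y ∘ (f ⊠ id one);
  lu_ru_one : fwd (lu one) = fwd (ru one) }.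

Record assoc_constraint (G : magmoidal) := AssocConstraint {
  phi :> forall A B C : G, iso (A ⊗ (B ⊗ C)) ((A ⊗ B) ⊗ C);
  phi_natural : forall (A A' B B' C C' : G)
    (f : hom A A') (g : hom B B') (h : hom C C'),
    ((f ⊠ g) ⊠ h) ∘ phi A B C = phi A' B' C' ∘ (f ⊠ (g ⊠ h)) }.

(* [monoidal_structure one]: the data and axioms turning a magmoidal category
   into a monoidal category with unit object [one]. *)
Record monoidal_structure (G : magmoidal) (one : G) := MonoidalStructure {
  monoidal_assoc : assoc_constraint G;
  monoidal_unit : unit_structure one;
  pentagon : forall A B C D : G,
    (monoidal_assoc A B C ⊠ id D) ∘ monoidal_assoc A (B ⊗ C) D
        ∘ (id A ⊠ monoidal_assoc B C D)
    = monoidal_assoc (A ⊗ B) C D ∘ monoidal_assoc A B (C ⊗ D);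
  triangle : forall A C : G,
    (ru monoidal_unit A ⊠ id C) ∘ monoidal_assoc A one C
    = id A ⊠ lu monoidal_unit C }.

Section FullSubcategory.

Variables (C : category) (P : C -> Prop).

Definition full_subcategory : category :=
  @Category {A : C | P A}
    (fun A B => hom (proj1_sig A) (proj1_sig B))
    (fun A => id (proj1_sig A))
    (fun A B D g f => g ∘ f)
    (fun A B f => comp_id_l f)
    (fun A B f => comp_id_r f)
    (fun A B D E h g f => comp_assoc h g f).

End FullSubcategory.

Definition full_submagmoidal (G : magmoidal) (P : G -> Prop)
    (closed : forall A B : G, P A -> P B -> P (A ⊗ B)) : magmoidal :=
  @Magmoidal (full_subcategory P)
    (fun A B => exist P (proj1_sig A ⊗ proj1_sig B)
                  (closed _ _ (proj2_sig A) (proj2_sig B)))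
    (fun A B D E f g => f ⊠ g)
    (fun A B => tensm_id (proj1_sig A) (proj1_sig B))
    (fun A B D A' B' D' g f g' f' => tensm_comp g f g' f').

Section LeftNucleus.

Variable G : magmoidal.

Definition nucleus_family (A : G) :=
  forall X Y : G, iso (A ⊗ (X ⊗ Y)) ((A ⊗ X) ⊗ Y).

Definition nucleus_natural (A : G) (a : nucleus_family A) : Prop :=
  forall (X X' Y Y' : G) (f : hom X X') (g : hom Y Y'),
    ((id A ⊠ f) ⊠ g) ∘ a X Y = a X' Y' ∘ (id A ⊠ (f ⊠ g)).

(* The inverses stored in the family are determined by the forward maps, so an
   object is a pair [(A, a)] in the usual sense. *)
Record nucleus_ob := NucleusOb {
  carrier : G;
  family : nucleus_family carrier;
  family_natural : nucleus_natural family }.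

Record nucleus_hom (A B : nucleus_ob) := NucleusHom {
  mor : hom (carrier A) (carrier B);
  mor_family : forall X Y : G,
    ((mor ⊠ id X) ⊠ id Y) ∘ family A X Y = family B X Y ∘ (mor ⊠ id (X ⊗ Y)) }.

Lemma nucleus_hom_eq (A B : nucleus_ob) (f g : nucleus_hom A B) :
  mor f = mor g -> f = g.
Proof.
case: f g => [f Hf] [g Hg] /= E; subst g.
by rewrite (proof_irrelevance _ Hf Hg).
Qed.

Definition nucleus_id (A : nucleus_ob) : nucleus_hom A A.
Proof.
refine (@NucleusHom A A (id (carrier A)) _).
by move=> X Y; rewrite !tensm_id comp_id_l comp_id_r.
Defined.

Definition nucleus_comp (A B C : nucleus_ob)
  (g : nucleus_hom B C) (f : nucleus_hom A B) : nucleus_hom A C.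
Proof.
refine (@NucleusHom A C (mor g ∘ mor f) _) => X Y.
rewrite -(comp_id_l (id X)) -(comp_id_l (id Y)) !tensm_comp -comp_assoc.
rewrite mor_family comp_assoc mor_family -comp_assoc -tensm_comp.
by rewrite comp_id_l.
Defined.

Lemma nucleus_hom_natural (A B : nucleus_ob) (f : nucleus_hom A B)
    (X X' Y Y' : G) (h : hom X X') (k : hom Y Y') :
  ((mor f ⊠ h) ⊠ k) ∘ family A X Y = family B X' Y' ∘ (mor f ⊠ (h ⊠ k)).
Proof.
transitivity (((mor f ⊠ id X') ⊠ id Y') ∘ (((id _ ⊠ h) ⊠ k) ∘ family A X Y)).
  by rewrite comp_assoc -!tensm_comp !comp_id_l comp_id_r.
rewrite family_natural comp_assoc mor_family -comp_assoc -tensm_comp.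
by rewrite comp_id_l comp_id_r.
Qed.

Definition left_nucleus_category : category.
Proof.
refine (@Category nucleus_ob nucleus_hom nucleus_id nucleus_comp _ _ _).
- by move=> A B f; apply: nucleus_hom_eq; apply: comp_id_l.
- by move=> A B f; apply: nucleus_hom_eq; apply: comp_id_r.
- by move=> A B C D h g f; apply: nucleus_hom_eq; apply: comp_assoc.
Defined.

(* The family [a|b], obtained from its defining equation [bar_familyE] by
   inverting [a_{B,X ⊗ Y}]. *)
Definition bar_family (A B : nucleus_ob) :
    nucleus_family (carrier A ⊗ carrier B) :=
  fun X Y =>
    iso_comp
      (iso_comp (iso_tens (family A (carrier B) X) (iso_id Y))
                (family A (carrier B ⊗ X) Y))
      (iso_comp (iso_tens (iso_id (carrier A)) (family B X Y))
                (iso_inv (family A (carrier B) (X ⊗ Y)))).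

Lemma bar_familyE (A B : nucleus_ob) (X Y : G) :
  bar_family A B X Y ∘ family A (carrier B) (X ⊗ Y)
  = (family A (carrier B) X ⊠ id Y) ∘ family A (carrier B ⊗ X) Y
      ∘ (id (carrier A) ⊠ family B X Y).
Proof. by rewrite /= -!comp_assoc bwd_fwd comp_id_r. Qed.

Lemma bar_family_natural_gen (A B C D : nucleus_ob)
    (f : nucleus_hom A B) (g : nucleus_hom C D)
    (X X' Y Y' : G) (h : hom X X') (k : hom Y Y') :
  (((mor f ⊠ mor g) ⊠ h) ⊠ k) ∘ bar_family A C X Y
  = bar_family B D X' Y' ∘ ((mor f ⊠ mor g) ⊠ (h ⊠ k)).
Proof.
apply: (@iso_epi _ _ _ _ (family A (carrier C) (X ⊗ Y))).
rewrite -comp_assoc bar_familyE -[RHS]comp_assoc nucleus_hom_natural.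
rewrite [RHS]comp_assoc bar_familyE -[RHS]comp_assoc -[in RHS]tensm_comp.
rewrite comp_id_l -nucleus_hom_natural -[in RHS](comp_id_r (mor f)) tensm_comp.
rewrite -[RHS]comp_assoc [X in _ = _ ∘ X]comp_assoc -nucleus_hom_natural.
by rewrite !comp_assoc -!tensm_comp nucleus_hom_natural comp_id_l comp_id_r.
Qed.

Lemma bar_family_natural (A B : nucleus_ob) : nucleus_natural (bar_family A B).
Proof.
move=> X X' Y Y' f g; rewrite -tensm_id.
exact: (bar_family_natural_gen (nucleus_id A) (nucleus_id B)).
Qed.

Definition nucleus_tens (A B : nucleus_ob) : nucleus_ob :=
  NucleusOb (@bar_family_natural A B).

Definition nucleus_tensm (A B C D : nucleus_ob)
  (f : nucleus_hom A B) (g : nucleus_hom C D) :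
  nucleus_hom (nucleus_tens A C) (nucleus_tens B D).
Proof.
refine (@NucleusHom (nucleus_tens A C) (nucleus_tens B D) (mor f ⊠ mor g) _).
by move=> X Y; rewrite /= bar_family_natural_gen tensm_id.
Defined.

Definition left_nucleus : magmoidal.
Proof.
refine (@Magmoidal left_nucleus_category nucleus_tens nucleus_tensm _ _).
- by move=> A B; apply: nucleus_hom_eq; apply: tensm_id.
- by move=> A B C A' B' C' g f g' f'; apply: nucleus_hom_eq; apply: tensm_comp.
Defined.

End LeftNucleus.

Section UnitalNucleus.

Variables (G : magmoidal) (one : G) (u : unit_structure one).

Definition unital (A : left_nucleus G) : Prop :=
  (forall X : G,
     (ru u (carrier A) ⊠ id X) ∘ family A one X = id (carrier A) ⊠ lu u X) /\
  (forall X : G,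
     ru u (carrier A ⊗ X) ∘ family A X one = id (carrier A) ⊠ ru u X).

(* [i_{X,Y} = (l_X ⊠ Y)^{-1} ∘ l_{X ⊗ Y}] *)
Definition unit_family : nucleus_family one :=
  fun X Y => iso_comp (iso_inv (iso_tens (lu u X) (iso_id Y))) (lu u (X ⊗ Y)).

Definition left_unital_nucleus : category := full_subcategory unital.

Definition left_unital_nucleus_magmoidal
    (closed : forall A B : left_nucleus G,
       unital A -> unital B -> unital (A ⊗ B)) : magmoidal :=
  full_submagmoidal closed.

Definition underlying (A B : left_unital_nucleus) (f : hom A B) :
    hom (carrier (proj1_sig A)) (carrier (proj1_sig B)) := mor f.

End UnitalNucleus.

(* Main.v *)
(* Since each [a_{B,X ⊗ Y}] is invertible, an identity involving [a|b] may be
   checked after precomposing with it, which turns [a|b] into its defining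
   composite; what remains is naturality.  In particular the pentagon is the
   definition of [a|b], and the triangle is the first normalisation
   condition. *)
From Stdlib Require Import ssreflect.
Require Import Defs.

Set Implicit Arguments.
Unset Strict Implicit.
Unset Printing Implicit Defensive.

Lemma iso_mono (C : category) (A B D : C) (i : iso B D) (g h : hom A B) :
  i ∘ g = i ∘ h -> g = h.
Proof.
move=> E; rewrite -(comp_id_l g) -(comp_id_l h) -(bwd_fwd i).
by rewrite -!comp_assoc E.
Qed.

Section Whiskering.

Variable G : magmoidal.

Lemma tensm_comp_l (A B C D : G) (g : hom B C) (f : hom A B) :
  (g ∘ f) ⊠ id D = (g ⊠ id D) ∘ (f ⊠ id D).
Proof. by rewrite -tensm_comp comp_id_l. Qed.

Lemma tensm_comp_r (A B C D : G) (g : hom B C) (f : hom A B) :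
  id D ⊠ (g ∘ f) = (id D ⊠ g) ∘ (id D ⊠ f).
Proof. by rewrite -tensm_comp comp_id_l. Qed.

End Whiskering.

Section Nucleus.

Variable G : magmoidal.

Lemma family_natural_l (A : nucleus_ob G) (X X' Y : G) (f : hom X X') :
  family A X' Y ∘ (id (carrier A) ⊠ (f ⊠ id Y))
  = ((id (carrier A) ⊠ f) ⊠ id Y) ∘ family A X Y.
Proof. by rewrite family_natural. Qed.

Lemma family_natural_r (A : nucleus_ob G) (X Y Y' : G) (f : hom Y Y') :
  family A X Y' ∘ (id (carrier A) ⊠ (id X ⊠ f))
  = (id (carrier A ⊗ X) ⊠ f) ∘ family A X Y.
Proof. by rewrite -family_natural tensm_id. Qed.

(** Both sides go from [A ⊗ (B ⊗ (C ⊗ (X ⊗ Y)))] to [(((A ⊗ B) ⊗ C) ⊗ X) ⊗ Y]. The two factors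
    [a_{B ⊗ C, X ⊗ Y}] and [A ⊗ b_{C, X ⊗ Y}] on the left are those needed to unfold first [a|(b|c)]
    and then the [b|c] inside it. *)
Lemma bar_family_tens_r (A B C : nucleus_ob G) (X Y : G) :
  ((family A (carrier B) (carrier C) ⊠ id X) ⊠ id Y)
    ∘ bar_family A (nucleus_tens B C) X Y
    ∘ family A (carrier B ⊗ carrier C) (X ⊗ Y)
    ∘ (id (carrier A) ⊠ family B (carrier C) (X ⊗ Y))
  = (bar_family A B (carrier C) X ⊠ id Y)
    ∘ bar_family A B (carrier C ⊗ X) Y
    ∘ (id (carrier A ⊗ carrier B) ⊠ family C X Y)
    ∘ family A (carrier B) (carrier C ⊗ (X ⊗ Y)).
Proof.
rewrite -[RHS]comp_assoc -family_natural_r [RHS]comp_assoc.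
rewrite -[in RHS](comp_assoc (_ ⊠ id Y)) bar_familyE.
rewrite -(comp_assoc _ (fwd (bar_family A _ X Y))).
rewrite (bar_familyE A (nucleus_tens B C)).
rewrite -!comp_assoc -!tensm_comp_r (bar_familyE B C) !tensm_comp_r.
(* Naturality of [a] moves [b_{C,X}] to the left of [a], next to [a_{B ⊗ C, X}]; there the factors
   tensored with [Y] are the defining composite of [(a|b)_{C,X}]. *)
rewrite !(comp_assoc (fwd (family A _ Y))) family_natural_l.
by rewrite !comp_assoc -!tensm_comp_l -bar_familyE.
Qed.

(** This makes [a_{B,C}] a morphism of the nucleus, hence a candidate associator. After cancelling
    two isomorphisms, the right side becomes that of [bar_family_tens_r] by the defining equations
    of [a|b] and [(a|b)|c]. *)
Lemma family_bar_mor (A B C : nucleus_ob G) (X Y : G) :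
  ((family A (carrier B) (carrier C) ⊠ id X) ⊠ id Y)
    ∘ bar_family A (nucleus_tens B C) X Y
  = bar_family (nucleus_tens A B) C X Y
    ∘ (family A (carrier B) (carrier C) ⊠ id (X ⊗ Y)).
Proof.
apply: (@iso_epi _ _ _ _ (family A (carrier B ⊗ carrier C) (X ⊗ Y))).
apply: (@iso_epi _ _ _ _
          (iso_tens (iso_id (carrier A)) (family B (carrier C) (X ⊗ Y)))).
apply: (eq_trans (bar_family_tens_r A B C X Y)).
rewrite -(comp_assoc (fwd (bar_family (nucleus_tens A B) C X Y))).
rewrite -[RHS]comp_assoc -(bar_familyE A B) [RHS]comp_assoc.
by rewrite (bar_familyE (nucleus_tens A B) C).
Qed.

(** Conjugating the morphism condition by [i] gives it for the inverse, so invertibility in the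
    nucleus can be checked in [G]. *)
Lemma nucleus_hom_inv (A B : nucleus_ob G) (i : iso (carrier A) (carrier B))
    (Hi : forall X Y : G,
      ((i ⊠ id X) ⊠ id Y) ∘ family A X Y = family B X Y ∘ (i ⊠ id (X ⊗ Y)))
    (X Y : G) :
  ((bwd i ⊠ id X) ⊠ id Y) ∘ family B X Y = family A X Y ∘ (bwd i ⊠ id (X ⊗ Y)).
Proof.
apply: (iso_mono (i := iso_tens (iso_tens i (iso_id X)) (iso_id Y))) => /=.
rewrite !comp_assoc Hi -!tensm_comp_l -(comp_assoc _ (i ⊠ _)) -tensm_comp_l.
by rewrite fwd_bwd !tensm_id comp_id_l comp_id_r.
Qed.

Definition nucleus_iso (A B : nucleus_ob G) (i : iso (carrier A) (carrier B))
    (Hi : forall X Y : G,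
      ((i ⊠ id X) ⊠ id Y) ∘ family A X Y = family B X Y ∘ (i ⊠ id (X ⊗ Y))) :
  @iso (left_nucleus G) A B.
Proof.
refine (@Iso (left_nucleus G) A B (NucleusHom Hi)
          (NucleusHom (nucleus_hom_inv Hi)) _ _).
- by apply: nucleus_hom_eq; apply: fwd_bwd.
- by apply: nucleus_hom_eq; apply: bwd_fwd.
Defined.

Definition nucleus_assoc (A B C : left_nucleus G) :
  iso (A ⊗ (B ⊗ C)) ((A ⊗ B) ⊗ C) :=
  @nucleus_iso (nucleus_tens A (nucleus_tens B C))
    (nucleus_tens (nucleus_tens A B) C) _ (@family_bar_mor A B C).

End Nucleus.

Definition full_iso (C : category) (P : C -> Prop) (A B : full_subcategory P)
    (i : iso (proj1_sig A) (proj1_sig B)) : iso A B :=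
  @Iso (full_subcategory P) A B (fwd i) (bwd i) (fwd_bwd i) (bwd_fwd i).

Section Unital.

Variables (G : magmoidal) (one : G) (u : unit_structure one).

(** Naturality of [l] at the morphism [l_X] itself, with the outer [l_X] cancelled. *)
Lemma lu_one_tens (X : G) : fwd (lu u (one ⊗ X)) = id one ⊠ lu u X.
Proof. by apply: (iso_mono (i := lu u X)); rewrite lu_natural. Qed.

Lemma unit_familyE (X Y : G) :
  (lu u X ⊠ id Y) ∘ unit_family u X Y = lu u (X ⊗ Y).
Proof. by rewrite /= comp_assoc -tensm_comp_l fwd_bwd tensm_id comp_id_l. Qed.

Lemma unit_family_natural : nucleus_natural (unit_family u).
Proof.
move=> X X' Y Y' f g.
apply: (iso_mono (i := iso_tens (lu u X') (iso_id Y'))).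
rewrite [LHS]comp_assoc [RHS]comp_assoc unit_familyE -lu_natural -unit_familyE.
by rewrite -tensm_comp -lu_natural comp_assoc -tensm_comp comp_id_l comp_id_r.
Qed.

Definition nucleus_unit : left_nucleus G := NucleusOb unit_family_natural.

Lemma unital_unit : unital u nucleus_unit.
Proof.
split=> X.
  (* The axiom [l_1 = r_1] turns the first normalisation condition into the defining equation of
     [i]. *)
  by rewrite -lu_ru_one -lu_one_tens; apply: unit_familyE.
(* Postcomposing with [l_X] allows naturality of [r] at [l_X], and then of [l] at [r_X]. *)
apply: (iso_mono (i := lu u X)).
by rewrite comp_assoc ru_natural -comp_assoc unit_familyE lu_natural.
Qed.

Lemma unital_tens (A B : left_nucleus G) :
  unital u A -> unital u B -> unital u (A ⊗ B).
Proof.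
case=> A1 A2 [B1 B2]; split=> X.
  (* The first condition for [a|b] combines the second condition for [a], taken at [B], with the
     first for [b]. *)
  apply: (@iso_epi _ _ _ _ (family A (carrier B) (one ⊗ X))).
  rewrite -comp_assoc bar_familyE !comp_assoc -tensm_comp_l A2.
  by rewrite -family_natural_l -comp_assoc -tensm_comp_r B1 family_natural_r.
(* Naturality of [r] at [a_{B,X}] exposes the second condition for [a] at [B ⊗ X]; the second
   condition for [b] then finishes. *)
apply: (@iso_epi _ _ _ _ (family A (carrier B) (X ⊗ one))).
rewrite -comp_assoc bar_familyE !comp_assoc -ru_natural -(comp_assoc (fwd _)).
by rewrite A2 -comp_assoc -tensm_comp_r B2 family_natural_r.
Qed.

(** After precomposition with [i_{A, X ⊗ Y}], every [i] is absorbed by an [l], leaving naturality of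
    [l] at [a_{X,Y}]. *)
Lemma lu_mor (A : left_nucleus G) (X Y : G) :
  ((lu u (carrier A) ⊠ id X) ⊠ id Y) ∘ bar_family nucleus_unit A X Y
  = family A X Y ∘ (lu u (carrier A) ⊠ id (X ⊗ Y)).
Proof.
apply: (@iso_epi _ _ _ _ (unit_family u (carrier A) (X ⊗ Y))).
rewrite -[LHS]comp_assoc -[RHS]comp_assoc unit_familyE.
rewrite (bar_familyE nucleus_unit) [LHS]comp_assoc (comp_assoc (_ ⊠ id Y)).
by rewrite -tensm_comp_l !unit_familyE lu_natural.
Qed.

(** The first normalisation condition, applied at [X] and at [X ⊗ Y], replaces each [r_A] by an [l],
    which the defining equation of [i] then matches. *)
Lemma ru_mor (A : left_nucleus G) (X Y : G) : unital u A ->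
  ((ru u (carrier A) ⊠ id X) ⊠ id Y) ∘ bar_family A nucleus_unit X Y
  = family A X Y ∘ (ru u (carrier A) ⊠ id (X ⊗ Y)).
Proof.
case=> A1 _; apply: (@iso_epi _ _ _ _ (family A one (X ⊗ Y))).
rewrite -[LHS]comp_assoc -[RHS]comp_assoc A1 (bar_familyE A nucleus_unit).
rewrite !comp_assoc -tensm_comp_l A1 -family_natural_l -comp_assoc.
by rewrite -tensm_comp_r unit_familyE.
Qed.

Definition nucleus_lu (A : left_nucleus G) : iso (nucleus_unit ⊗ A) A :=
  @nucleus_iso _ (nucleus_tens nucleus_unit A) A _ (@lu_mor A).

Definition nucleus_ru (A : left_nucleus G) (HA : unital u A) :
  iso (A ⊗ nucleus_unit) A :=
  @nucleus_iso _ (nucleus_tens A nucleus_unit) A _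
    (fun X Y => ru_mor X Y HA).

Definition unital_nucleus : magmoidal :=
  left_unital_nucleus_magmoidal unital_tens.

Definition unital_one : unital_nucleus := exist (unital u) nucleus_unit unital_unit.

Definition unital_assoc : assoc_constraint unital_nucleus.
Proof.
refine (@AssocConstraint unital_nucleus
  (fun A B C => full_iso (A := A ⊗ (B ⊗ C)) (B := (A ⊗ B) ⊗ C)
     (nucleus_assoc (proj1_sig A) (proj1_sig B) (proj1_sig C)))
  _).
move=> A A' B B' C C' f g h; apply: nucleus_hom_eq.
(* Naturality in the first variable is the morphism condition on [f]; in the other two it is
   naturality of the family. *)
exact: nucleus_hom_natural.
Defined.

Definition unital_unit_structure : unit_structure unital_one.
Proof.
refine (@UnitStructure unital_nucleus unital_one
  (fun A => full_iso (A := unital_one ⊗ A) (B := A)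
     (nucleus_lu (proj1_sig A)))
  (fun A => full_iso (A := A ⊗ unital_one) (B := A)
     (nucleus_ru (proj2_sig A)))
  _ _ _).
- by move=> A B f; apply: nucleus_hom_eq; apply: lu_natural.
- by move=> A B f; apply: nucleus_hom_eq; apply: ru_natural.
- by apply: nucleus_hom_eq; apply: lu_ru_one.
Defined.

Definition unital_monoidal : monoidal_structure unital_one.
Proof.
refine (@MonoidalStructure unital_nucleus unital_one
          unital_assoc unital_unit_structure _ _).
- move=> A B C D; apply: nucleus_hom_eq; symmetry; exact: bar_familyE.
- move=> A C; apply: nucleus_hom_eq; exact: (proj1 (proj2_sig A)).
Defined.

End Unital.

Theorem theorem2p2p2 (G : magmoidal) (one : G) (u : unit_structure one) :
  exists (closed : forall A B : left_nucleus G,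
            unital u A -> unital u B -> unital u (A ⊗ B))
         (i_natural : nucleus_natural (unit_family u))
         (i_unital : unital u (NucleusOb i_natural))
         (M : @monoidal_structure (left_unital_nucleus_magmoidal closed)
                (exist (unital u) (NucleusOb i_natural) i_unital)),
    (forall A B C : left_unital_nucleus u,
       underlying (monoidal_assoc M A B C)
       = family (proj1_sig A) (carrier (proj1_sig B)) (carrier (proj1_sig C))) /\
    (forall A : left_unital_nucleus u,
       underlying (lu (monoidal_unit M) A) = lu u (carrier (proj1_sig A))) /\
    (forall A : left_unital_nucleus u,
       underlying (ru (monoidal_unit M) A) = ru u (carrier (proj1_sig A))).
Proof.
(* The constructions carrying data are transparent, so the three descriptions of the constraints
   hold by computation. *)
by exists (unital_tens (u := u)), (unit_family_natural u), (unital_unit u),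
  (unital_monoidal u).
Qed.
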